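(* Let $n, k \in \mathbb{N}$, let $a_1,\ldots,a_k \in \mathbb{Z}$ be pairwise distinct integers, and let $X, Y \in \mathbb{Z}^{n\times n}$ be two matrices both having minimal polynomial $\prod_{i=1}^k (t-a_i) \in \mathbb{Z}[t]$. Let $e_1,\ldots,e_k \in \mathbb{Q}[X] \subseteq \mathbb{Q}^{n\times n}$ be the primitive idempotents of the $\mathbb{Q}$-algebra $\mathbb{Q}[X]$, for each $i$ let $q_i\in\mathbb{N}$ be minimal such that $E_i := q_i e_i \in \mathbb{Z}^{n\times n}$, and assume that at least one of the following two statements holds: (a) for all $1\leq i\leq k$ the Smith group of $E_i$ has exponent $q_i$; (b) $\mathrm{rk}(e_1) = 1$ and for all $2\leq i\leq k$ the Smith group of $E_i$ has exponent $q_i$. Then there is some $T \in \mathrm{GL}_n(\mathbb{Z})$ with $TXT^{-1} = Y$ if and only if for all primes $p$ there is a matrix $T_p \in \mathrm{GL}_n(\mathbb{Z}_{(p)})$ with $T_p X T_p^{-1} = Y$.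
   Context: For a prime $p$, $\mathbb{Z}_{(p)} = \{ a/b \in \mathbb{Q} \mid p \nmid b\}$ is the localization of $\mathbb{Z}$ at $p$. $\mathrm{GL}_n(\mathbb{Z})$ is the group of integral $n\times n$ matrices with determinant $\pm 1$, and $\mathrm{GL}_n(\mathbb{Z}_{(p)})$ is the group of $n\times n$ matrices over $\mathbb{Z}_{(p)}$ whose determinant is a unit of $\mathbb{Z}_{(p)}$ (not divisible by $p$). For $A \in \mathbb{Z}^{n\times n}$ there are $g,h\in \mathrm{GL}_n(\mathbb{Z})$ such that $gAh = \mathrm{diag}(d_1,\ldots,d_r,0,\ldots,0)$ with $d_i \in \mathbb{N}$ (positive integers) and $d_1\mid d_2\mid\cdots\mid d_r$. The tuple $(d_1,\ldots,d_r)$ is uniquely determined by $A$ and called the abelian invariants of $A$. The Smith group of $A$ is the torsion part of the cokernel of the endomorphism $A$ of $\mathbb{Z}^n$; it is isomorphic to $\mathbb{Z}/d_1\mathbb{Z}\times\cdots\times\mathbb{Z}/d_r\mathbb{Z}$ and its exponent is $d_r$. Since the $a_i$ are pairwise distinct, $\mathbb{Q}[X] \cong \bigoplus_{i=1}^k \mathbb{Q}[t]/(t-a_i) \cong \bigoplus_{i=1}^k \mathbb{Q}$, and $e_i$ denotes the primitive idempotent corresponding to the $i$-th summand, i.e. the projection onto the eigenspace of $X$ for the eigenvalue $a_i$. *)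

(* Defs.v *)
From HB Require Import structures.
From mathcomp Require Import all_boot all_order all_algebra.
From mathcomp Require Import boolp.

Set Implicit Arguments.
Unset Strict Implicit.
Unset Printing Implicit Defensive.

Import Order.TTheory GRing.Theory Num.Theory.
Local Open Scope ring_scope.

Definition ratM (m n : nat) (A : 'M[int]_(m, n)) : 'M[rat]_(m, n) :=
  map_mx (intr : int -> rat) A.

Definition integralM (m n : nat) (M : 'M[rat]_(m, n)) : Prop :=
  exists A : 'M[int]_(m, n), M = ratM A.

(* mxminpoly is only available over a field, hence the passage to rat. *)
Definition has_minpoly (n : nat) (A : 'M[int]_n.+1) (f : {poly int}) : Prop :=
  mxminpoly (ratM A) = map_poly (intr : int -> rat) f.

Section PrimitiveIdempotents.
Variables (n : nat) (X : 'M[rat]_n.+1).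

Definition in_Qalg (M : 'M[rat]_n.+1) : Prop :=
  exists f : {poly rat}, M = horner_mx X f.

Definition idempotent_of (e : 'M[rat]_n.+1) : Prop := in_Qalg e /\ e * e = e.

(* Q[X] is commutative, so f * g = 0 is orthogonality on both sides. *)
Definition primitive_idempotent_of (e : 'M[rat]_n.+1) : Prop :=
  [/\ idempotent_of e, e != 0
    & forall f g : 'M[rat]_n.+1, idempotent_of f -> idempotent_of g ->
        f * g = 0 -> e = f + g -> f = 0 \/ g = 0].

(* [eigenspace] is the space of row eigenvectors; since e is a polynomial in X,
   an idempotent e projects onto the row eigenspace of X for c if and only if
   it projects onto the column eigenspace. *)
Definition eigen_idempotent (c : rat) (e : 'M[rat]_n.+1) : Prop :=
  primitive_idempotent_of e /\ (e == eigenspace X c)%MS.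

End PrimitiveIdempotents.

Definition min_denom (m n : nat) (M : 'M[rat]_(m, n)) (q : nat) : Prop :=
  [/\ (0 < q)%N, integralM (M *+ q)
    & forall d : nat, (0 < d)%N -> integralM (M *+ d) -> (q <= d)%N].

Section Cokernel.
Variables (n : nat) (A : 'M[int]_n).

Definition im_mx : {pred 'cV[int]_n} :=
  [pred v | `[< exists w : 'cV[int]_n, v = A *m w >]].

Fact im_mx_zmod_closed : zmod_closed im_mx.
Proof.
split=> [|u v /asboolP[x ->] /asboolP[y ->]]; apply/asboolP.
  by exists 0; rewrite mulmx0.
by exists (x - y); rewrite mulmxBr.
Qed.

HB.instance Definition _ :=
  GRing.isZmodClosed.Build 'cV[int]_n im_mx im_mx_zmod_closed.

(* Despite its name, {ideal_quot _} is the quotient of a Z-module by any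
   subgroup. *)
Definition coker : zmodType := {ideal_quot im_mx}.

End Cokernel.

Definition torsion (V : zmodType) (x : V) : Prop :=
  exists2 m : nat, (0 < m)%N & x *+ m = 0.

Definition smith_group (n : nat) (A : 'M[int]_n) : coker A -> Prop :=
  @torsion (coker A).
Arguments smith_group {n} A.

Definition has_exponent (V : zmodType) (S : V -> Prop) (d : nat) : Prop :=
  [/\ (0 < d)%N, forall x : V, S x -> x *+ d = 0
    & forall c : nat, (0 < c)%N -> (forall x : V, S x -> x *+ c = 0) ->
        (d <= c)%N].

Definition in_Zloc (p : nat) (x : rat) : Prop :=
  exists a b : int, ~~ (p%:Z %| b)%Z /\ x = a%:~R / b%:~R.

(* x != 0 is needed because 0^-1 = 0 in rat. *)
Definition unit_Zloc (p : nat) (x : rat) : Prop :=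
  [/\ in_Zloc p x, x != 0 & in_Zloc p x^-1].

Definition in_GL_Zloc (p n : nat) (T : 'M[rat]_n) : Prop :=
  (forall i j, in_Zloc p (T i j)) /\ unit_Zloc p (\det T).

(* Main.v *)
(* Each e_i factors as P_i Q_i with Q_i integral, Q_i P_i = 1 and Q_i
   right-invertible over Z; write f_i = P'_i Q'_i for the corresponding idempotents
   of Y, and let m kill the denominators of all P_i and P'_i.  Combining finitely
   many local conjugators gives an integral T with T X = Y T and det T prime to m;
   then T = \sum_i P'_i C_i Q_i with integral blocks C_i of determinant prime to m.
   The exponent condition on E_i produces an integral eigenvector v and an integral
   eigenfunctional w of X with w v = 1, so 1 + (u - 1) v w commutes with X and
   multiplies det C_i by u without changing the other blocks; in case (b) the block
   C_1 is a scalar, corrected by rescaling T.  So one may assume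
   det C_i = 1 mod m^2.  As SL_r(Z) -> SL_r(Z/m^2) is onto, C_i is congruent to a
   unimodular G_i, and \sum_i P'_i G_i Q_i is the wanted global conjugator: it is
   integral and congruent to T mod m, hence has determinant prime to m, while m
   times its inverse is integral. *)
Require Import Defs.
From mathcomp Require Import all_boot all_order all_algebra.
From mathcomp Require Import boolp ring.

Set Implicit Arguments.
Unset Strict Implicit.
Unset Printing Implicit Defensive.

Import Order.TTheory GRing.Theory Num.Theory.
Local Open Scope ring_scope.

(** * Rank-one determinants and congruences of integer matrices *)

Lemma det_1_add_rank1 (R : comNzRingType) n (v : 'cV[R]_n) (w : 'rV[R]_n) :
  \det (1%:M + v *m w) = 1 + (w *m v) 0 0.
Proof.
(* [e1] and [e2] factor one block matrix into triangular ones in two ways; comparing determinants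
   gives the identity. *)
have e1 : block_mx 1%:M (- w) v 1%:M
  = block_mx 1%:M 0 v 1%:M *m block_mx 1%:M (- w) 0 (1%:M + v *m w).
  rewrite mulmx_block !mul1mx !mul0mx ?mulmx0 ?mulmx1 ?addr0 mulmxN.
  by rewrite ?addr0 addrC addrK.
have e2 : block_mx 1%:M (- w) v 1%:M
  = block_mx 1%:M (- w) 0 1%:M *m block_mx (1%:M + w *m v) 0 v 1%:M.
  rewrite mulmx_block !mul1mx !mul0mx ?mulmx0 ?mulmx1 ?add0r mulNmx.
  by rewrite addrK.
have := congr1 determinant e1.
rewrite e2 !det_mulmx !det_lblock !det_ublock !det1 !mul1r mulr1 => <-.
by rewrite det_mx11 !mxE.
Qed.

Definition congmx (m : int) (p q : nat) (A B : 'M[int]_(p, q)) : Prop :=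
  exists K, A = B + m *: K.

Lemma congmx_trans m p q (B A C : 'M_(p, q)) :
  congmx m A B -> congmx m B C -> congmx m A C.
Proof.
by move=> [K ->] [K' ->]; exists (K' + K); rewrite scalerDr addrA.
Qed.

Lemma congmxM m p q r (A A' : 'M_(p, q)) (B B' : 'M_(q, r)) :
  congmx m A A' -> congmx m B B' -> congmx m (A *m B) (A' *m B').
Proof.
move=> [K ->] [K' ->]; exists (A' *m K' + K *m (B' + m *: K')).
by rewrite mulmxDl mulmxDr scalerDr addrA -scalemxAl -scalemxAr.
Qed.

Lemma congmx_det m n (A B : 'M_n) : congmx m A B -> (m %| \det A - \det B)%Z.
Proof.
case=> K ->; rewrite -sumrB; apply: rpred_sum => s _.
rewrite -mulrBr dvdz_mull //.
apply: (big_ind2 (fun x y => (m %| x - y)%Z)) => [|x1 x2 y1 y2 dx dy|i _].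
- by rewrite subrr dvdz0.
- rewrite [X in (_ %| X)%Z](_ : _ = (x1 - x2) * y1 + x2 * (y1 - y2)); last first.
    by rewrite /=; ring.
  by rewrite rpredD // ?(dvdz_mull _ dy) ?(dvdz_mulr _ dx).
- by rewrite !mxE addrAC subrr add0r dvdz_mulr.
Qed.

Lemma coprimez_dvdB (m x y : int) :
  (m %| x - y)%Z -> coprimez x m = coprimez y m.
Proof.
move=> /dvdzP[k e]; have -> : x = k * m + y by rewrite -e subrK.
by rewrite coprimez_sym /coprimez gcdzMDl -/(coprimez m y) coprimez_sym.
Qed.

Lemma unitz_sqr (x : int) : x \is a GRing.unit -> x * x = 1.
Proof. by case/orP=> /eqP ->. Qed.

(** * Unimodular lifts modulo [m] *)

Definition liftable (m : int) n (A : 'M[int]_n) : Prop :=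
  exists2 G : 'M[int]_n, G \in unitmx & congmx m A G.

Lemma liftable_congmx m n (A B : 'M_n) :
  congmx m A B -> liftable m B -> liftable m A.
Proof. by move=> AB [G uG BG]; exists G => //; apply: congmx_trans BG. Qed.

Lemma liftableM m n (A B : 'M_n) :
  liftable m A -> liftable m B -> liftable m (A *m B).
Proof.
move=> [G uG AG] [H uH BH]; exists (G *m H); first by rewrite unitmx_mul uG.
exact: congmxM.
Qed.

Lemma liftable_unit m n (A : 'M_n) : A \in unitmx -> liftable m A.
Proof. by move=> uA; exists A => //; exists 0; rewrite scaler0 addr0. Qed.

(* [[u, m], [m t, z']] with [u z' - m^2 t = 1] lifts diag(u, z). *)
Lemma liftable_diag2 m n (i j : 'I_n) (u z : int) :
  i != j -> (m %| u * z - 1)%Z ->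
  liftable m (1%:M + (u - 1) *: delta_mx i i + (z - 1) *: delta_mx j j).
Proof.
move=> nij /dvdzP[a e].
have uz : u * z = 1 + a * m by rewrite -e; ring.
(* A Newton step turns [z], an inverse of [u] modulo [m], into an inverse [z'] modulo [m * m]:
   indeed [u * z'] equals 1 - a^2 m^2. *)
pose t := - (a * a); pose z' := z * (2 - u * z).
have E : u * z' - m * m * t - 1 = 0.
  have -> : u * z' - m * m * t - 1 = (u * z) * (2 - u * z) - 1 - m * m * t.
    by rewrite /z'; ring.
  by rewrite uz /t; ring.
pose H (x y b c : int) : 'M[int]_n :=
  1%:M + (x - 1) *: delta_mx i i + (y - 1) *: delta_mx j j +
  b *: delta_mx i j + c *: delta_mx j i.
have HH : H u z' m (m * t) *m H z' u (- m) (- (m * t)) = 1%:M.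
  rewrite /H !mulmxDl !mulmxDr !mul1mx !mulmx1 -!scalemxAl -!scalemxAr.
  rewrite !mul_delta_mx_cond !eqxx (eq_sym j i) (negPf nij) !mulr0n !mulr1n.
  move: (delta_mx i i) (delta_mx i j) (delta_mx j i) (delta_mx j j).
  move=> a1 a2 a3 a4; apply/matrixP => k l; rewrite !mxE.
  apply/eqP; rewrite -subr_eq0; apply/eqP.
  set d := (k == l)%:R.
  transitivity ((a1 k l + a4 k l) * (u * z' - m * m * t - 1)); first by ring.
  by rewrite E mulr0.
exists (H u z' m (m * t)).
  by have /mulmx1_unit[] := HH.
exists ((a * z) *: delta_mx j j - delta_mx i j - t *: delta_mx j i).
rewrite /H; move: (delta_mx i i) (delta_mx i j) (delta_mx j i) (delta_mx j j).
move=> a1 a2 a3 a4; apply/matrixP => k l; rewrite !mxE.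
by rewrite /z' uz; ring.
Qed.

(** Induction on [s], which lists the positions other than 0 whose entry may differ from 1. Each
    step moves one entry into position 0 by means of [liftable_diag2]; in the end only an entry
    congruent to [eps] remains there. *)
Lemma liftable_diag m r (eps : int) (s : seq 'I_r.+1) (d : 'I_r.+1 -> int) :
  eps \is a GRing.unit -> uniq s -> ord0 \notin s ->
  (forall j, j != ord0 -> j \notin s -> d j = 1) ->
  (m %| \prod_j d j - eps)%Z -> liftable m (diag_mx (\row_j d j)).
Proof.
move=> ueps; elim: s d => [|j s IHs] d.
  move=> _ _ d1; rewrite (bigD1 ord0) //= big1 ?mulr1 => [|j nj]; last exact: d1.
  move=> /dvdzP[a e].
  exists (diag_mx (\row_j if j == ord0 then eps else 1)).
    rewrite unitmxE det_diag (bigD1 ord0) //= big1 ?mulr1 ?mxE //.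
    by move=> j nj; rewrite !mxE (negPf nj).
  exists (a *: delta_mx ord0 ord0); apply/matrixP => k l; rewrite !mxE.
  have [-> | nl] := eqVneq l ord0.
    have [-> | nk] := eqVneq k ord0; last by rewrite !mulr0n !mulr0 addr0.
    by rewrite !mulr1n /= mulr1 [m * a]mulrC -e; ring.
  rewrite andbF !mulr0 addr0; have [-> | //] := eqVneq k l.
  by rewrite (negPf nl) d1.
rewrite /= in_cons negb_or => /andP[js us] /andP[nj0 s0] d1 dv.
have n0j : j != ord0 by rewrite eq_sym.
pose d' i := if i == ord0 then d ord0 * d j else if i == j then 1 else d i.
have prodE : \prod_i d i = d ord0 * d j * \prod_(i | (i != ord0) && (i != j)) d i.
  by rewrite (bigD1 ord0) // (bigD1 j) //= mulrA.
have prod' : \prod_i d' i = \prod_i d i.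
  rewrite prodE (bigD1 ord0) // (bigD1 j) //= /d' eqxx (negPf n0j) eqxx mul1r.
  by congr (_ * _); apply: eq_bigr => i /andP[/negPf -> /negPf ->].
(* The product of all entries is [eps] modulo [m] and [eps * eps] is 1, so [z] inverts [d j].
   Multiplying [d'] by [z] at 0 and by [d j] at [j] gives back [d] modulo [m]. *)
pose z := d ord0 * \prod_(i | (i != ord0) && (i != j)) d i * eps.
have zdj : (m %| z * d j - 1)%Z.
  have -> : z * d j - 1 = (\prod_i d i - eps) * eps.
    by rewrite mulrBl unitz_sqr // prodE /z; ring.
  exact: dvdz_mulr.
have lift' : liftable m (diag_mx (\row_i d' i)).
  apply: IHs => //; last by rewrite prod'.
  move=> i ni0 nis; rewrite /d' (negPf ni0); case: eqVneq => // nij.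
  by apply: d1; rewrite // in_cons negb_or nij.
apply: liftable_congmx (liftableM lift' (liftable_diag2 nj0 zdj)).
have [a e] := dvdzP zdj.
exists (- (a * d ord0) *: delta_mx ord0 ord0).
rewrite mul_diag_mx; apply/matrixP => k l; rewrite !mxE /d'.
have [-> | nk] := eqVneq k ord0.
  have [-> | nl] := eqVneq l ord0.
    rewrite (negPf nj0) /= mulr1n mulr1 mulr0 addr0.
    transitivity (d ord0 * (z * d j - 1 - a * m) + d ord0); last by ring.
    by rewrite e subrr mulr0 add0r.
  by rewrite (negPf nj0) /= !mulr0n; ring.
rewrite /= ?mulr0n; have [-> | nkj] := eqVneq k j.
  have [_ | nlj] := eqVneq j l.
    by rewrite ?eqxx /= ?mulr1n; ring.
  by rewrite /= ?mulr0n; ring.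
have [-> | nlj] := eqVneq k l; rewrite /= ?mulr0n ?mulr1n; ring.
Qed.

(** The Smith form reduces to diagonal matrices, and allowing either sign for [eps] absorbs the
    determinants of [L] and [R]. For [eps] = 1 this is the surjectivity of SL_r(Z) -> SL_r(Z/m). *)
Lemma liftable_det m r (eps : int) (A : 'M_r) :
  eps \is a GRing.unit -> (m %| \det A - eps)%Z -> liftable m A.
Proof.
case: r A => [|r] A ueps dA.
  by apply: liftable_unit; rewrite unitmxE det_mx00 unitr1.
have [L uL [R uR [d _ AE]]] := int_Smith_normal_form A.
rewrite AE; apply: liftableM (liftable_unit _ uR).
apply: liftableM (liftable_unit _ uL) _.
have -> : \matrix_(i < r.+1, j < r.+1) (d`_i *+ (i == j :> nat))
   = diag_mx (\row_i d`_i).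
  apply/matrixP => i j; rewrite !mxE.
  by have [-> | ] := eqVneq i j; rewrite ?eqxx // -val_eqE /= => /negPf ->.
apply: (@liftable_diag m r (\det L * eps * \det R)
  (rem ord0 (enum 'I_r.+1)) (fun i => d`_i)).
- by rewrite !unitrM -!unitmxE uL uR ueps.
- by rewrite rem_uniq ?enum_uniq.
- by rewrite mem_rem_uniq ?enum_uniq // inE eqxx.
- by move=> j nj; rewrite mem_rem_uniq ?enum_uniq // !inE nj mem_enum.
have detA : \det A = \det L * \prod_(i < r.+1) d`_i * \det R.
  rewrite {1}AE !det_mulmx; congr (_ * _ * _).
  rewrite det_trig.
    by apply: eq_bigr => i _; rewrite mxE eqxx.
  apply/is_trig_mxP => i j ltij; rewrite mxE.
  by case: eqP => // eij; rewrite eij ltnn in ltij.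
have -> : \prod_(i < r.+1) d`_i - \det L * eps * \det R
     = \det L * (\det A - eps) * \det R.
  have uuL := @unitz_sqr (\det L); have uuR := @unitz_sqr (\det R).
  rewrite -!unitmxE in uuL uuR; rewrite detA mulrBr mulrBl; congr (_ - _).
  have -> : \det L * (\det L * \prod_(i < r.+1) d`_i * \det R) * \det R
    = (\det L * \det L) * (\det R * \det R) * \prod_(i < r.+1) d`_i by ring.
  by rewrite uuL // uuR // !mul1r.
by rewrite dvdz_mulr // dvdz_mull.
Qed.

(** * Smith groups and integral eigenvectors *)

Lemma pi_coker_eq0 n (E : 'M[int]_n) (v : 'cV_n) c :
  ((\pi_(coker E) v)%qT *+ c = 0) <-> exists w, v *+ c = E *m w.
Proof.
have -> : (\pi_(coker E) v)%qT *+ c = (\pi_(coker E) (v *+ c))%qT by rewrite raddfMn.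
have -> : (0 : coker E) = (\pi_(coker E) 0)%qT by rewrite raddf0.
split=> [/eqP | [w e]].
  by rewrite -Quotient.idealrBE subr0 => /asboolP.
by apply/eqP; rewrite -Quotient.idealrBE subr0; apply/asboolP; exists w.
Qed.

(* In a Smith form E = L D R with E^2 = q E, the largest invariant d_j is the
   exponent q; the j-th column of L and the j-th row of R are then eigenvectors,
   and the (j, j) entry of D (R L) D = q D shows that they pair to a unit. *)
Lemma exponent_eigenvectors n (E : 'M[int]_n) (q : nat) :
  E != 0 -> E *m E = q%:Z *: E -> has_exponent (smith_group E) q ->
  exists (v : 'cV[int]_n) (w : 'rV[int]_n),
    [/\ w *m v = 1%:M, E *m v = q%:Z *: v & w *m E = q%:Z *: w].
Proof.
move=> nzE EE [q_gt0 _ q_min].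
have [L uL [R uR [d sd defE]]] := int_Smith_normal_form E.
set D := \matrix_(i, j) _ in defE.
have DE (u : 'cV[int]_n) i : (D *m u) i 0 = d`_i * u i 0.
  rewrite mxE (bigD1 i) //= big1 ?addr0 => [|l nl]; rewrite mxE ?eqxx //.
  by rewrite eq_sym val_eqE (negPf nl) mul0r.
have [j0 nzj0] : exists j : 'I_n, d`_j != 0.
  apply/existsP; apply: contraNT nzE; rewrite negb_exists => /forallP d0.
  rewrite defE; suff -> : D = 0 by rewrite mulmx0 mul0mx.
  apply/matrixP => i l; rewrite !mxE.
  by have := d0 i; rewrite negbK => /eqP ->; rewrite mul0rn.
(* Take [j] to be the last index with d_j nonzero; by the divisibility chain every nonzero d_l
   divides d_j. *)
case: (@arg_maxnP _ j0 (fun j : 'I_n => d`_j != 0) (fun j => val j) nzj0).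
move=> j nzj maxj {j0 nzj0}.
have dvd_dj l : d`_(l : 'I_n) != 0 -> (d`_l %| d`_j)%Z.
  move=> nzl; have trd : transitive dvdz by move=> ? ? ?; apply: dvdz_trans.
  have /= := sorted_leq_nth trd dvdzz 0 sd; apply.
  - by apply: contraNT nzl; rewrite inE -leqNgt => sl; rewrite nth_default.
  - by apply: contraNT nzj; rewrite inE -leqNgt => sl; rewrite nth_default.
  - exact: maxj.
have mulmxMn (A : 'M[int]_n) (u : 'cV[int]_n) k : A *m (u *+ k) = (A *m u) *+ k.
  exact: (raddfMn (mulmx A)).
have DRLD : D *m (R *m L) *m D = q%:Z *: D.
  have := EE; rewrite defE => /(congr1 (fun M => invmx L *m M *m invmx R)).
  rewrite -scalemxAr -scalemxAl !mulmxA mulVmx // mul1mx mulmxK //.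
  by rewrite mulmxK.
have RLjj : d`_j * (R *m L) j j = q%:Z.
  apply: (mulIf nzj).
  have := congr1 (fun M : 'M[int]_n => M *m delta_mx j (0 : 'I_1)) DRLD.
  move=> /(congr1 (fun M : 'cV[int]_n => M j 0)).
  have Dj : D *m delta_mx j 0 = d`_j *: delta_mx j 0 :> 'cV_n.
    apply/matrixP => k l; rewrite ord1 DE !mxE.
    by rewrite eqxx andbT; have [-> | ] := eqVneq k j; rewrite ?mulr0.
  rewrite -!mulmxA Dj -!scalemxAr [R *m (L *m _)]mulmxA -colE -scalemxAl Dj. 
  rewrite mxE DE; move: (R *m L) => M; rewrite !mxE !eqxx mulr1 => <-.
  by ring.
pose c : nat := absz (d`_j)%R.
have dj_dvd_q : (c %| q)%N.
  by have := dvdz_mulr ((R *m L) j j) (dvdzz (d`_j)); rewrite RLjj.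
(* By minimality of [q] it suffices that d_j kills torsion. In the basis given by [L], a torsion
   class has zero coordinates where d_l = 0; elsewhere d_l divides d_j, so [y] below is integral. *)
have dj_ge_q : (q <= c)%N.
  apply: q_min; first by rewrite /c absz_gt0.
  move=> x [m m_gt0]; rewrite -(reprK x) => /pi_coker_eq0[w vE].
  set v := repr x in vE *; apply/pi_coker_eq0.
  have [v' defv] : exists v', v = L *m v'.
    by exists (invmx L *m v); rewrite mulmxA mulmxV // mul1mx.
  have v'E : v' *+ m = D *m (R *m w).
    have -> : v' = invmx L *m v by rewrite defv mulmxA mulVmx // mul1mx.
    by rewrite -mulmxMn vE defE !mulmxA mulVmx // mul1mx.
  pose y := \col_l if d`_l == 0 then 0 else divz (v' l 0 * c%:Z) d`_l.
  exists (invmx R *m y); rewrite defv.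
  rewrite defE -!mulmxA [R *m _]mulmxA mulmxV // mul1mx -mulmxMn.
  congr (_ *m _); apply/matrixP => l k; rewrite ord1 DE mulmxnE mxE.
  have [dl0 | nzl] := eqVneq.
    rewrite mulr0; have := congr1 (fun M : 'cV[int]_n => M l 0) v'E.
    rewrite DE dl0 mul0r mulmxnE => /eqP; rewrite mulrn_eq0 eqn0Ngt m_gt0 /=.
    by move=> /eqP ->; rewrite mul0rn.
  rewrite [RHS]mulrC divzK ?dvdz_mull //; first by rewrite -mulr_natr natz.
  by have := dvd_dj l nzl; rewrite !dvdzE.
have djq : c = q.
  by apply/eqP; rewrite eqn_leq dj_ge_q dvdn_leq.
(* Since d_j and [q] agree up to sign, [x] is 1 or -1; scaling row [j] of [R] by [x] turns the
   pairing [x] with column [j] of [L] into 1. *)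
pose x := (R *m L) j j.
have xx : x * x = 1.
  have absx : absz x = 1%N.
    have /eqP := congr1 absz RLjj.
    by rewrite abszM -/c djq -[X in _ == X]muln1 eqn_pmul2l // => /eqP.
  by rewrite (intEsign x) absx mulr1 -expr2 sqrr_sign.
have cancel_dj p r (A B : 'M[int]_(p, r)) : d`_j *: A = d`_j *: B -> A = B.
  move=> /matrixP AB; apply/matrixP => k l.
  by have := AB k l; rewrite !mxE => /(mulfI nzj).
have Lj : E *m (invmx R *m delta_mx j 0) = d`_j *: col j L.
  rewrite defE -!mulmxA [R *m _]mulmxA mulmxV // mul1mx.
  rewrite [col j L]colE scalemxAr; congr (_ *m _).
  apply/matrixP => k l; rewrite ord1 DE !mxE.
  by rewrite eqxx andbT; have [-> | ] := eqVneq k j; rewrite ?mulr0.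
have Rj : (delta_mx 0 j : 'rV_n) *m invmx L *m E = d`_j *: row j R.
  rewrite defE !mulmxA mulmxKV // [row j R]rowE scalemxAl; congr (_ *m _).
  rewrite -rowE; apply/matrixP => k l; rewrite ord1 !mxE.
  by rewrite eqxx /= [l == j]eq_sym -val_eqE mulr_natr.
exists (col j L), (x *: row j R); split.
- apply/matrixP => k l; rewrite !ord1 -scalemxAl !mxE eqxx mulr1n -[RHS]xx.
  by congr (_ * _); rewrite /x mxE; apply: eq_bigr => i _; rewrite !mxE.
- apply: cancel_dj; rewrite scalerA mulrC -scalerA -Lj.
  by rewrite scalemxAr -Lj mulmxA EE scalemxAl.
- rewrite -scalemxAl scalerA mulrC -scalerA; congr (_ *: _); apply: cancel_dj.
  rewrite scalerA mulrC -scalerA -Rj scalemxAl -Rj.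
  by rewrite -[_ *m E *m E]mulmxA EE scalemxAr.
Qed.

(** * Integral and rational matrices, clearing denominators *)

Lemma ratMM m n p (A : 'M_(m, n)) (B : 'M_(n, p)) :
  ratM (A *m B) = ratM A *m ratM B.
Proof. exact: map_mxM. Qed.

Lemma ratMD m n (A B : 'M_(m, n)) : ratM (A + B) = ratM A + ratM B.
Proof. exact: map_mxD. Qed.

Lemma ratMZ m n c (A : 'M_(m, n)) : ratM (c *: A) = c%:~R *: ratM A.
Proof. exact: map_mxZ. Qed.

Lemma ratM1 n : ratM 1%:M = 1%:M :> 'M_n.
Proof. exact: map_mx1. Qed.

Lemma ratM_inj m n : injective (@ratM m n).
Proof.
move=> A B /matrixP e; apply/matrixP => i j.
by have := e i j; rewrite !mxE => /intr_inj.
Qed.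

Lemma ratM_unit n (A : 'M[int]_n) : A \in unitmx -> ratM A \in unitmx.
Proof. by rewrite !unitmxE det_map_mx; apply: rmorph_unit. Qed.

(** A common denominator whose prime factors all divide the denominator of some entry; it is
    therefore prime to [p] for matrices over Z_(p). *)
Definition denom_prod m n (M : 'M[rat]_(m, n)) : int :=
  \prod_i \prod_j denq (M i j).

Lemma denom_prod_neq0 m n (M : 'M_(m, n)) : denom_prod M != 0.
Proof.
by apply/prodf_neq0 => i _; apply/prodf_neq0 => j _; apply: denq_neq0.
Qed.

Lemma denom_prodP m n (M : 'M_(m, n)) :
  exists A, ratM A = (denom_prod M)%:~R *: M.
Proof.
exists (\matrix_(i, j) (numq (M i j) * divz (denom_prod M) (denq (M i j)))).
apply/matrixP => i j; rewrite !mxE rmorphM /= numqE -mulrA -rmorphM /=.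
rewrite [denq _ * _]mulrC divzK 1?mulrC //.
by rewrite /denom_prod (bigD1 i) //= (bigD1 j) //= -mulrA dvdz_mulr.
Qed.

(** * From local conjugators to an integral intertwiner *)

Lemma Euclid_dvdzM (p : nat) (x y : int) :
  prime p -> (p %| x * y)%Z = (p %| x)%Z || (p %| y)%Z.
Proof. by move=> pp; rewrite !dvdzE abszM Euclid_dvdM. Qed.

Lemma Euclid_dvdzX (p : nat) (x : int) k :
  prime p -> (p %| x ^+ k)%Z -> (p %| x)%Z.
Proof. by move=> pp; rewrite !dvdzE abszX Euclid_dvdX // => /andP[]. Qed.

Lemma primez_dvd_prod (p : nat) (I : finType) (F : I -> int) :
  prime p -> (p %| \prod_i F i)%Z -> exists i, (p %| F i)%Z.
Proof.
move=> pp; pose dvd_factor x := (p %| x)%Z -> exists i, (p %| F i)%Z.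
apply: (big_ind dvd_factor) => [|x y IHx IHy|i _]; rewrite /dvd_factor.
- by rewrite dvdz1 /= gtn_eqF ?prime_gt1.
- by rewrite Euclid_dvdzM // => /orP[/IHx|/IHy].
- by exists i.
Qed.

Lemma Zloc_denq p x : in_Zloc p x -> ~~ (p %| denq x)%Z.
Proof.
move=> [a [b [npb xE]]]; apply: contra npb => /dvdz_trans; apply.
have [-> | nzb] := eqVneq b 0; first exact: dvdz0.
have e : numq x * b = a * denq x.
  apply: (@intr_inj rat); rewrite !rmorphM /= numqE xE mulrAC divfK //.
  by rewrite intr_eq0.
have : (denq x %| numq x * b)%Z by rewrite e dvdz_mull.
by rewrite Gauss_dvdzr // coprimez_sym /coprimez; apply: coprime_num_den.
Qed.

Lemma Zloc_int p (x : int) : prime p -> in_Zloc p x%:~R.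
Proof.
move=> pp; exists x, 1; rewrite divr1; split=> //.
by rewrite dvdz1 /= gtn_eqF ?prime_gt1.
Qed.

Lemma conjugate_intertwine n (T : 'M[rat]_n) X Y :
  T \in unitmx -> T *m X *m invmx T = Y -> T *m X = Y *m T.
Proof. by move=> uT <-; rewrite mulmxKV. Qed.

(** Scaling [T] by its common denominator, which is prime to [p], makes it integral, and the
    determinant only gains a factor prime to [p]. *)
Lemma local_intertwiner n (X Y : 'M[int]_n) (p : nat) (T : 'M[rat]_n) :
  prime p -> in_GL_Zloc p T -> T *m ratM X *m invmx T = ratM Y ->
  exists2 T' : 'M[int]_n, T' *m X = Y *m T' & ~~ (p %| \det T')%Z.
Proof.
move=> pp [Tp detT] TXY.
have uT : T \in unitmx by case: detT => _; rewrite unitmxE unitfE.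
have [A AE] := denom_prodP T.
have npd : ~~ (p %| denom_prod T)%Z.
  apply/negP => /(primez_dvd_prod pp)[i /(primez_dvd_prod pp)[j]].
  exact/negP/Zloc_denq.
exists A.
  apply: ratM_inj; rewrite !ratMM AE -scalemxAl (conjugate_intertwine uT TXY).
  by rewrite scalemxAr.
have detA : (\det A)%:~R = ((denom_prod T) ^+ n)%:~R * \det T.
  by rewrite -det_map_mx -/(ratM A) AE detZ rmorphXn.
have detTE : \det T = (numq (\det T))%:~R / (denq (\det T))%:~R.
  by rewrite divq_num_den.
have e : \det A * denq (\det T) = denom_prod T ^+ n * numq (\det T).
  apply: (@intr_inj rat); rewrite !rmorphM /= detA numqE; ring.
have npn : ~~ (p %| numq (\det T))%Z.
  case: detT => _ nz0 [a [b [npb bE]]]; apply: contra npb => pn.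
  have nzb : b != 0.
    by apply: contraNneq nz0 => b0; rewrite -invr_eq0 bE b0 invr0 mulr0.
  have eb : a * numq (\det T) = b * denq (\det T).
    apply: (@intr_inj rat); rewrite !rmorphM /= numqE mulrA; congr (_ * _).
    have -> : (a%:~R : rat) = (\det T)^-1 * b%:~R.
      by rewrite bE divfK // intr_eq0.
    by rewrite mulrAC mulVf ?mul1r.
  have pbd : (p %| b * denq (\det T))%Z by rewrite -eb dvdz_mull.
  move: pbd; rewrite Euclid_dvdzM // => /orP[] //; rewrite dvdzE => pd.
  have := coprime_num_den (\det T); rewrite /coprime => /eqP cop.
  have : (p %| 1)%N by rewrite -cop dvdn_gcd andbC pd.
  by rewrite dvdn1 => /eqP p1; rewrite p1 in pp.
apply/negP => pA; have : (p %| \det A * denq (\det T))%Z by rewrite dvdz_mulr.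
rewrite e Euclid_dvdzM // => /orP[|]; last exact/negP.
by move=> /(Euclid_dvdzX pp); exact/negP.
Qed.

(** Intertwiners form a Z-module, so the Chinese remainder idea applies: with [m] the product of
    [s], the sum [p%:Z *: T + m *: U] is a multiple of [U] modulo [p] and of [T] modulo each prime
    in [s], by factors prime to the respective modulus. *)
Lemma semilocal_intertwiner n (X Y : 'M[int]_n) (s : seq nat) :
  (forall p : nat, prime p ->
    exists2 T : 'M[int]_n, T *m X = Y *m T & ~~ (p %| \det T)%Z) ->
  uniq s -> all prime s ->
  exists2 T : 'M[int]_n, T *m X = Y *m T & {in s, forall p : nat, ~~ (p %| \det T)%Z}.
Proof.
move=> loc; elim: s => [|p s IHs] /=.
  by exists 0; rewrite ?mul0mx ?mulmx0.
move=> /andP[ps us] /andP[pp prs].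
have [T TXY Ts] := IHs us prs; have [U UXY Up] := loc p pp.
pose m : int := (\prod_(l <- s) l)%N%:Z.
have primeX (l : nat) (x y : int) k : prime l -> ~~ (l %| x)%Z -> ~~ (l %| y)%Z ->
    ~~ (l %| x ^+ k * y)%Z.
  move=> pl nx ny; rewrite Euclid_dvdzM // negb_or ny andbT.
  by apply: contra nx; exact: Euclid_dvdzX.
have ndvd (l : nat) (A B : 'M_n) : congmx l A B ->
    ~~ (l %| \det A)%Z -> ~~ (l %| \det B)%Z.
  move=> AB; apply: contra => lB; rewrite -[\det A](subrK (\det B)).
  by rewrite rpredD // congmx_det.
exists (p%:Z *: T + m *: U).
  by rewrite mulmxDl mulmxDr -!scalemxAl -!scalemxAr TXY UXY.
move=> l; rewrite in_cons => /predU1P[-> | ls].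
  apply: (@ndvd p (m *: U)).
    by exists (- T); rewrite scalerN [p%:Z *: T + _]addrC addrK.
  rewrite detZ; apply: primeX => //; apply: contra ps => pm.
  have {pm} : (p %| \prod_(l <- s) l)%N by [].
  rewrite Euclid_dvd_prod // big_has => /hasP[i si]; rewrite dvdn_prime2 ?(allP prs i) //.
  by move=> /eqP ->.
apply: (@ndvd l (p%:Z *: T)).
  have /dvdnP[k mE] : (l %| \prod_(l <- s) l)%N by rewrite (big_rem l) //= dvdn_mulr.
  exists (- (k%:Z *: U)); rewrite scalerN scalerA mulrC -PoszM -mE.
  by rewrite -/m addrK.
have pl := allP prs l ls.
rewrite detZ; apply: primeX => //; last exact: Ts.
rewrite dvdzE /= dvdn_prime2 //; apply: contraNneq ps => <- //.
Qed.

Lemma coprime_intertwiner n (X Y : 'M[int]_n) (m : int) :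
  (forall p : nat, prime p ->
    exists2 T : 'M[int]_n, T *m X = Y *m T & ~~ (p %| \det T)%Z) ->
  m != 0 ->
  exists2 T : 'M[int]_n, T *m X = Y *m T & coprimez (\det T) m.
Proof.
move=> loc nzm.
have := @semilocal_intertwiner n X Y (primes `|m|) loc (primes_uniq _) _.
case=> [|T TXY Tm]; first by apply/allP => p; rewrite mem_primes => /andP[].
exists T => //; rewrite coprimezE /coprime; apply: contraT => ngcd.
have gcd_gt0 : (0 < gcdn `|\det T| `|m|)%N by rewrite gcdn_gt0 !absz_gt0 nzm orbT.
have gcd_gt1 : (1 < gcdn `|\det T| `|m|)%N by rewrite ltn_neqAle eq_sym ngcd.
have := pdiv_dvd (gcdn `|\det T| `|m|); rewrite dvdn_gcd => /andP[dT dm].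
have := Tm (pdiv (gcdn `|\det T| `|m|)).
by rewrite mem_primes pdiv_prime // absz_gt0 nzm dm /= dvdzE /= dT => /(_ isT).
Qed.

(** * Splitting idempotents along integral lattices *)

Lemma idempotent_split n (e : 'M[rat]_n) r :
  e *m e = e -> \rank e = r ->
  exists (P : 'M[rat]_(n, r)) (Q : 'M[int]_(r, n)) (S : 'M[int]_(n, r)),
    [/\ P *m ratM Q = e, ratM Q *m P = 1%:M & Q *m S = 1%:M].
Proof.
move=> ee <- {r}; set r := \rank e; have le_rn : (r <= n)%N := rank_leq_row e.
have [P0 [Q0 [PQ0 fP0 fQ0]]] : exists (P0 : 'M[rat]_(n, r)) (Q0 : 'M[rat]_(r, n)),
    [/\ P0 *m Q0 = e, row_full P0 & row_free Q0].
  by exists (col_base e), (row_base e); rewrite mulmx_base col_base_full row_base_free.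
have QP0 : Q0 *m P0 = 1%:M.
  apply: (row_full_inj fP0); apply: (row_free_inj fQ0) => /=.
  by rewrite mulmx1 !mulmxA PQ0 -mulmxA PQ0.
have [A0 A0E] := denom_prodP Q0; set c := denom_prod Q0 in A0E.
have nzc : (c%:~R : rat) != 0 by rewrite intr_eq0 denom_prod_neq0.
have [L uL [R uR [d _ AE]]] := int_Smith_normal_form A0.
(* The first [r] rows of the unimodular [R] form a basis of the integral vectors in the row space of
   [e], a direct summand of Z^n; hence the right inverse [S]. The rational base change [K] leads
   back to [Q0]. *)
pose Q : 'M[int]_(r, n) := pid_mx r *m R.
pose K := c%:~R^-1 *: ratM (L *m diag_mx (\row_i d`_i)).
have Q0E : Q0 = K *m ratM Q.
  rewrite -scalemxAl -ratMM; transitivity (c%:~R^-1 *: (c%:~R *: Q0)).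
    by rewrite scalerA mulVf // scale1r.
  rewrite -A0E AE.
  congr (_ *: ratM _); rewrite /Q !mulmxA; congr (_ *m _).
  rewrite -mulmxA; congr (_ *m _); rewrite mul_diag_mx.
  by apply/matrixP => i j; rewrite !mxE ltn_ord andbT mulr_natr.
have uK : K \in unitmx.
  rewrite -row_free_unit -kermx_eq0; move: fQ0.
  rewrite -kermx_eq0 Q0E => /eqP ker0; rewrite -submx0 -ker0.
  by apply/sub_kermxP; rewrite mulmxA mulmx_ker mul0mx.
have QE : ratM Q = invmx K *m Q0 by rewrite Q0E mulKmx.
exists (P0 *m K), Q, (invmx R *m pid_mx r); split.
- by rewrite -mulmxA -Q0E.
- by rewrite QE !mulmxA -[_ *m Q0 *m P0]mulmxA QP0 mulmx1 mulVmx.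
- rewrite /Q mulmxA mulmxK // pid_mx_id // pid_mx_1 //.
Qed.

Lemma coprimez_inv (x m : int) : coprimez x m -> exists u, (m %| x * u - 1)%Z.
Proof.
move=> /coprimezP[[u v] /= e]; exists u; apply/dvdzP; exists (- v).
by rewrite -e; ring.
Qed.

Lemma coprimez_dvdB1 (x m : int) : (m %| x - 1)%Z -> coprimez x m.
Proof. by move=> /coprimez_dvdB ->; exact: coprime1n. Qed.

Lemma common_multiple (k : nat) (p q : 'I_k -> nat) (P : forall i, 'M[rat]_(p i, q i)) :
  exists2 m : int, m != 0 & forall i, exists A, ratM A = m%:~R *: P i.
Proof.
exists (\prod_i denom_prod (P i)).
  by apply/prodf_neq0 => i _; exact: denom_prod_neq0.
move=> i; have [A AE] := denom_prodP (P i).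
exists ((\prod_(j | j != i) denom_prod (P j)) *: A).
by rewrite ratMZ AE scalerA -intrM [in RHS](bigD1 i) //= mulrC.
Qed.

(** Then [v *m w] is an integral idempotent of rank one inside [e], which allows the determinant of
    a single block to be changed. *)
Definition fixed_pairing n (e : 'M[rat]_n) : Prop :=
  exists (v : 'cV[int]_n) (w : 'rV[int]_n),
    [/\ w *m v = 1%:M, e *m ratM v = ratM v & ratM w *m e = ratM w].

(** * Adjusting the blocks and assembling a global conjugator *)

Section Assembly.

Variables (n k : nat) (a : 'I_k -> int) (X Y : 'M[int]_n).
Variables (e f : 'I_k -> 'M[rat]_n).
Hypothesis orth : forall i j, i != j -> e i *m e j = 0.
Hypothesis sumf : \sum_i f i = 1%:M.
Hypothesis eX : forall i, e i *m ratM X = (a i)%:~R *: e i.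
Hypothesis Xe : forall i, ratM X *m e i = (a i)%:~R *: e i.
Hypothesis Yf : forall i, ratM Y *m f i = (a i)%:~R *: f i.
Hypothesis ef : forall T : 'M[int]_n, T *m X = Y *m T ->
  forall i, ratM T *m e i = f i *m ratM T.

Variables (r : 'I_k -> nat).
Variables (P P' : forall i, 'M[rat]_(n, r i)) (Q Q' : forall i, 'M[int]_(r i, n)).
Variables (S S' : forall i, 'M[int]_(n, r i)).
Hypothesis PQ : forall i, P i *m ratM (Q i) = e i.
Hypothesis QP : forall i, ratM (Q i) *m P i = 1%:M.
Hypothesis QS : forall i, Q i *m S i = 1%:M.
Hypothesis PQ' : forall i, P' i *m ratM (Q' i) = f i.
Hypothesis QP' : forall i, ratM (Q' i) *m P' i = 1%:M.
Hypothesis QS' : forall i, Q' i *m S' i = 1%:M.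

(** For an intertwiner [T], this is the matrix of right multiplication by [T] from the lattice with
    basis [Q' i] to the one with basis [Q i], as [CQ] shows. *)
Let C (T : 'M[int]_n) i : 'M[int]_(r i) := Q' i *m T *m S i.

Let eSQ i p (w : 'M[int]_(p, n)) (z : 'M[rat]_(p, n)) :
  ratM w = z *m e i -> w *m S i *m Q i = w.
Proof.
move=> wE; apply: ratM_inj; rewrite !ratMM wE -PQ -!mulmxA.
by rewrite [ratM (Q i) *m (_ *m _)]mulmxA -ratMM QS ratM1 mul1mx.
Qed.

Let CQ (T : 'M[int]_n) i : T *m X = Y *m T -> C T i *m Q i = Q' i *m T.
Proof.
move=> TXY; apply: (@eSQ _ _ _ (ratM (Q' i) *m ratM T)).
by rewrite -mulmxA ef // -PQ' !mulmxA QP' mul1mx ratMM.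
Qed.

(** [Q i *m \adj T *m S' i] inverts the block up to the factor [\det T], so the determinant of the
    block divides a power of [\det T]. *)
Let C_coprime (T : 'M[int]_n) i (M : int) :
  T *m X = Y *m T -> coprimez (\det T) M -> coprimez (\det (C T i)) M.
Proof.
move=> TXY cop.
have : C T i *m (Q i *m \adj T *m S' i) = (\det T)%:M.
  rewrite !mulmxA CQ // -[Q' i *m T *m _]mulmxA mul_mx_adj.
  by rewrite mul_mx_scalar -scalemxAl QS' scalemx1.
move/(congr1 determinant); rewrite det_mulmx det_scalar => detC.
have : coprimez (\det T ^+ r i) M by exact: coprimezXl.
by rewrite -detC coprimezMl => /andP[].
Qed.

Let QeP i j : i != j -> ratM (Q i) *m P j = 0.
Proof.
move=> nij.
have -> : ratM (Q i) *m P j = ratM (Q i) *m (e i *m e j) *m P j.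
  by rewrite -!PQ !mulmxA QP mul1mx -mulmxA QP mulmx1.
by rewrite orth // mulmx0 mul0mx.
Qed.

(** Multiply [T] on the right by [s], where [u] inverts the determinant of block [j] modulo [M]. The
    other blocks are unchanged because [Q i *m v] vanishes for [i != j]. *)
Let adjust_det (T : 'M[int]_n) (M : int) j :
  T *m X = Y *m T -> coprimez (\det T) M -> fixed_pairing (e j) ->
  exists T' : 'M[int]_n, [/\ T' *m X = Y *m T', coprimez (\det T') M,
    (M %| \det (C T' j) - 1)%Z &
    forall i, i != j -> C T' i = C T i].
Proof.
move=> TXY cop [v [w [wv ev we]]].
have [u uE] := coprimez_inv (C_coprime j TXY cop).
have Xv : X *m v = a j *: v.
  by apply: ratM_inj; rewrite ratMM ratMZ -ev mulmxA Xe scalemxAl.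
have wX : w *m X = a j *: w.
  by apply: ratM_inj; rewrite ratMM ratMZ -we -mulmxA eX scalemxAr.
pose s := 1%:M + ((u - 1) *: v) *m w.
have dets : \det s = u.
  by rewrite det_1_add_rank1 -scalemxAr wv !mxE eqxx mulr1 addrC subrK.
have CTs i : C (T *m s) i = C T i *m (Q i *m s *m S i).
  by rewrite /C !mulmxA -/(C T i) CQ.
exists (T *m s); split.
- rewrite -mulmxA; have -> : s *m X = X *m s.
    rewrite /s mulmxDl mulmxDr mul1mx mulmx1 -mulmxA wX -scalemxAr.
    rewrite [X *m (_ *m w)]mulmxA -[X *m _]scalemxAr Xv.
    by rewrite [_ *: (_ *: v)]scalerA mulrC -scalerA -[_ *m w]scalemxAl.
  by rewrite mulmxA TXY mulmxA.
- rewrite det_mulmx dets coprimezMl cop /=.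
  by have := coprimez_dvdB1 uE; rewrite coprimezMl => /andP[].
- rewrite CTs det_mulmx; suff -> : \det (Q j *m s *m S j) = u by [].
  rewrite mulmxDr mulmxDl mulmx1 QS mulmxA -mulmxA det_1_add_rank1.
  have wSQ : w *m S j *m Q j = w by apply: (@eSQ _ _ _ (ratM w)); rewrite we.
  by rewrite -scalemxAr -scalemxAr mulmxA wSQ wv !mxE eqxx mulr1 addrC subrK.
- move=> i nij; rewrite CTs mulmxDr mulmxDl mulmx1 QS.
  have Qv : Q i *m v = 0.
    apply: ratM_inj; rewrite ratMM -ev -PQ !mulmxA QeP //.
    by rewrite !mul0mx /ratM map_mx0.
  by rewrite mulmxA -scalemxAr Qv scaler0 !mul0mx addr0 mulmx1.
Qed.

(** [A] marks blocks that are normalized beforehand and must survive the adjustments; in case (b)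
    this is the scalar block. *)
Let adjust_dets (T : 'M[int]_n) (M : int) (A : pred 'I_k) (s : seq 'I_k) :
  T *m X = Y *m T -> coprimez (\det T) M ->
  (forall i, A i -> (M %| \det (C T i) - 1)%Z) ->
  {in s, forall j, fixed_pairing (e j)} ->
  exists T' : 'M[int]_n, [/\ T' *m X = Y *m T', coprimez (\det T') M &
    forall i, A i || (i \in s) -> (M %| \det (C T' i) - 1)%Z].
Proof.
move=> TXY cop TA; elim: s => [|j s IHs] hs.
  by exists T; split=> // i; rewrite orbF; exact: TA.
have [i si|T1 [TXY1 cop1 TA1]] := IHs; first by apply: hs; rewrite in_cons si orbT.
have [|T' [TXY' cop' T'j T'i]] := @adjust_det T1 M j TXY1 cop1.
  by apply: hs; rewrite mem_head.
exists T'; split=> // i; have [-> // | nij] := eqVneq i j.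
by rewrite in_cons (negPf nij) T'i //=; exact: TA1.
Qed.

Let lift_intertwiner (m : int) (PA PA' : forall i, 'M[int]_(n, r i)) (T : 'M[int]_n) :
  (forall i, ratM (PA i) = m%:~R *: P i) ->
  (forall i, ratM (PA' i) = m%:~R *: P' i) ->
  T *m X = Y *m T -> coprimez (\det T) m ->
  (forall i, liftable (m * m) (C T i)) ->
  exists2 T' : 'M[int]_n, T' \in unitmx & T' *m X = Y *m T'.
Proof.
move=> PAE PAE' TXY cop lift.
have [G uG /fin_all_exists[K CGK]] := fin_all_exists2 lift.
(* This replaces each block [C T i] by [G i]. Of the two factors [m] in the congruence, one clears
   the denominators of [P' i] and the other keeps [T'] congruent to [T] modulo [m]. *)
pose T' := T - m *: \sum_i PA' i *m K i *m Q i.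
have T'E : ratM T' = \sum_i P' i *m ratM (G i) *m ratM (Q i).
  have -> : ratM T' = ratM T - \sum_i (m * m)%:~R *: (P' i *m ratM (K i) *m ratM (Q i)).
    rewrite /T' [LHS]map_mxB -/(ratM T) [X in _ - X]ratMZ; congr (_ - _).
    rewrite [ratM _]map_mx_sum scaler_sumr; apply: eq_bigr => i _.
    by rewrite -/(ratM _) !ratMM PAE' -!scalemxAl scalerA -intrM.
  have -> : ratM T = \sum_i P' i *m ratM (C T i) *m ratM (Q i).
    rewrite -[LHS]mul1mx -sumf mulmx_suml; apply: eq_bigr => i _.
    by rewrite -PQ' -!mulmxA -!ratMM CQ.
  rewrite -sumrB; apply: eq_bigr => i _.
  rewrite CGK ratMD ratMZ mulmxDr mulmxDl -scalemxAr -scalemxAl.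
  by rewrite addrK.
have T'XY : T' *m X = Y *m T'.
  apply: ratM_inj; rewrite !ratMM T'E mulmx_suml mulmx_sumr.
  apply: eq_bigr => i _.
  have QX : ratM (Q i) *m ratM X = (a i)%:~R *: ratM (Q i).
    have -> : ratM (Q i) = ratM (Q i) *m e i by rewrite -PQ mulmxA QP mul1mx.
    by rewrite -mulmxA eX scalemxAr.
  have YP : ratM Y *m P' i = (a i)%:~R *: P' i.
    have -> : P' i = f i *m P' i by rewrite -PQ' -mulmxA QP' mulmx1.
    by rewrite mulmxA Yf scalemxAl.
  by rewrite -mulmxA QX !mulmxA YP -scalemxAr -!scalemxAl.
exists T' => //.
(* [U] is [m] times the inverse of [T']. Its integrality makes [\det T'] divide [m ^+ n], to which
   it is also coprime. *)
pose U := \sum_i PA i *m invmx (G i) *m Q' i.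
have TU : T' *m U = m%:M.
  apply: ratM_inj; rewrite ratMM T'E /U [ratM (\sum_i _)]map_mx_sum mulmx_suml.
  transitivity (\sum_i m%:~R *: f i).
    apply: eq_bigr => i _; rewrite mulmx_sumr (bigD1 i) //= big1 => [|j nji].
      rewrite addr0 -/(ratM _) !ratMM PAE -!scalemxAl -!scalemxAr !mulmxA.
      rewrite -[_ *m ratM (Q i) *m P i]mulmxA QP mulmx1 -PQ'.
      rewrite -[_ *m ratM (G i) *m _]mulmxA -ratMM mulmxV ?uG //.
      by rewrite ratM1 mulmx1.
    rewrite -/(ratM _) !ratMM PAE -!scalemxAl -!scalemxAr !mulmxA.
    rewrite -[_ *m ratM (Q i) *m P j]mulmxA QeP 1?eq_sym // mulmx0 !mul0mx.
    exact: scaler0.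
  by rewrite -scaler_sumr sumf /ratM map_scalar_mx /= scalemx1.
have cop' : coprimez (\det T') m.
  rewrite (@coprimez_dvdB m _ (\det T)) //; apply: congmx_det.
  by exists (- \sum_i PA' i *m K i *m Q i); rewrite scalerN.
have dvd_mn : (\det T' %| m ^+ n)%Z.
  by rewrite -det_scalar -TU det_mulmx dvdz_mulr.
have : coprimez (\det T') (\det T').
  by apply: (coprime_dvdr dvd_mn); apply: coprimezXr.
rewrite coprimezE /coprime gcdnn unitmxE; move: (\det T') => d /eqP d1.
by rewrite (intEsign d) d1 mulr1 unitrX ?unitrN1.
Qed.

Lemma intertwiner_unimodular :
  (forall i, fixed_pairing (e i)) \/
    (exists2 i0, r i0 = 1%N & forall i, i != i0 -> fixed_pairing (e i)) ->
  (forall p : nat, prime p ->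
    exists2 T : 'M[int]_n, T *m X = Y *m T & ~~ (p %| \det T)%Z) ->
  exists2 T : 'M[int]_n, T \in unitmx & T *m X = Y *m T.
Proof.
move=> pairing loc.
have [m1 nzm1 /fin_all_exists[PA PAE]] := common_multiple P.
have [m2 nzm2 /fin_all_exists[PA' PAE']] := common_multiple P'.
pose m := m1 * m2.
have nzm : m != 0 by rewrite mulf_neq0.
have [T0 TXY0] := coprime_intertwiner loc (mulf_neq0 nzm nzm).
move=> cop0.
have [T [TXY cop Tdet]] : exists T : 'M[int]_n, [/\ T *m X = Y *m T,
    coprimez (\det T) (m * m) & forall i, (m * m %| \det (C T i) - 1)%Z].
  case: pairing => [hs | [i0 ri0 hs]].
    have [//|j _|T [TXY cop Tdet]] :=
      @adjust_dets T0 (m * m) pred0 (enum 'I_k) TXY0 cop0; first exact: hs.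
    by exists T; split=> // i; apply: Tdet; rewrite mem_enum.
  (* Block [i0] has size 1, so scaling [T0] by [u] makes its determinant 1 modulo [m * m]. The other
     blocks are normalized afterwards through their pairings. *)
  have [u uE] := coprimez_inv (C_coprime i0 TXY0 cop0).
  have copu : coprimez u (m * m).
    by have := coprimez_dvdB1 uE; rewrite coprimezMl => /andP[].
  have [||i|j|T [TXY cop Tdet]] :=
    @adjust_dets (u *: T0) (m * m) (pred1 i0) (enum (predC1 i0)).
  - by rewrite -scalemxAl -scalemxAr TXY0.
  - by rewrite detZ coprimezMl cop0 andbT coprimezXl.
  - move=> /eqP ->; rewrite /C -scalemxAr -scalemxAl -/(C T0 i0) detZ.
    by rewrite [X in u ^+ X]ri0 expr1 mulrC.
  - by rewrite mem_enum => nj; apply: hs.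
  - by exists T; split=> // i; apply: Tdet; rewrite mem_enum !inE orbN.
apply: (@lift_intertwiner m (fun i => m2 *: PA i) (fun i => m1 *: PA' i) T) => //.
- by move=> i; rewrite ratMZ PAE scalerA -intrM mulrC.
- by move=> i; rewrite ratMZ PAE' scalerA -intrM.
- by move: cop; rewrite coprimezMr => /andP[].
- by move=> i; apply: (liftable_det (eps := 1)).
Qed.

End Assembly.

(** * Polynomials in a matrix and its eigenprojections *)

Lemma horner_mx_intertwine (R : comNzRingType) n (T X Y : 'M[R]_n.+1) (g : {poly R}) :
  T *m X = Y *m T -> T *m horner_mx X g = horner_mx Y g *m T.
Proof.
move=> TXY; elim/poly_ind: g => [|g c IHg]; first by rewrite !rmorph0 mulmx0 mul0mx.
rewrite !rmorphD !rmorphM /= !horner_mx_X !horner_mx_C mulmxDr mulmxDl.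
rewrite mulmxA IHg -mulmxA TXY mulmxA; congr (_ + _).
by rewrite mul_mx_scalar mul_scalar_mx.
Qed.

Section EigenIdempotents.

Variables (F : fieldType) (n k : nat) (X : 'M[F]_n.+1) (a : 'I_k -> F).
Variable e : 'I_k -> 'M[F]_n.+1.
Hypothesis a_inj : injective a.
Hypothesis minpolyX : mxminpoly X = \prod_i ('X - (a i)%:P).
Hypothesis eX_comm : forall i, e i * X = X * e i.
Hypothesis e_idem : forall i, e i * e i = e i.
Hypothesis e_eigen : forall i, (e i == eigenspace X (a i))%MS.

Lemma eigen_idempotentE i : e i * X = a i *: e i.
Proof. by apply/eigenspaceP; case/andP: (e_eigen i). Qed.

Lemma eigen_idempotent_orth i j : i != j -> e i * e j = 0.
Proof.
move=> nij; have e1 : a i *: (e i * e j) = a j *: (e i * e j).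
  by rewrite scalerAl -eigen_idempotentE -mulrA -eX_comm eigen_idempotentE scalerAr.
apply/eqP; have /eqP : (a i - a j) *: (e i * e j) = 0.
  by rewrite scalerBl e1 subrr.
by rewrite scaler_eq0 subr_eq0 (inj_eq a_inj) (negPf nij).
Qed.

(** The complement [z] kills every [e i], and the minimal polynomial gives [z] times the product of
    all X - a_i equal to 0. Factors peel off one at a time: if [M] times X - a_j vanishes, the rows
    of [M] lie in the image of [e j], so [M = M * e j], which is 0 because [e j] commutes past the
    polynomial to meet [z]. *)
Lemma eigen_idempotent_sum : \sum_i e i = 1.
Proof.
pose z := 1 - \sum_i e i.
have ze i : z * e i = 0.
  rewrite mulrBl mul1r mulr_suml (bigD1 i) //= e_idem big1 ?addr0 ?subrr //.
  by move=> j nji; rewrite eigen_idempotent_orth.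
suff z0 : z = 0 by apply/eqP; rewrite eq_sym -subr_eq0 -/z z0.
have : z * horner_mx X (\prod_(i <- enum 'I_k) ('X - (a i)%:P)) = 0.
  by rewrite big_enum -minpolyX mx_root_minpoly mulr0.
elim: (enum _) => [|j s IHs]; first by rewrite big_nil rmorph1 mulr1.
rewrite big_cons mulrC rmorphM mulrA rmorphB /= horner_mx_X horner_mx_C.
set M := z * _ => Mj; apply: IHs; rewrite -/M.
have : (M <= eigenspace X (a j))%MS.
  apply/eigenspaceP; apply/eqP; rewrite -subr_eq0 -mul_mx_scalar -mulmxBr.
  by apply/eqP.
case/andP: (e_eigen j) => _ /(submx_trans _) /[apply] /submxP[D MD].
have -> : M = M * e j by rewrite MD -[RHS]mulrA e_idem.
have comm_ej : GRing.comm (e j) (horner_mx X (\prod_(i <- s) ('X - (a i)%:P))).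
  by apply: comm_mx_horner; exact: eX_comm.
by rewrite -mulrA -comm_ej mulrA ze mul0r.
Qed.

End EigenIdempotents.

(** * The local-global criterion for conjugacy *)

Lemma fixed_pairing_exponent n (e : 'M[rat]_n) (q : nat) (E : 'M[int]_n) :
  e *m e = e -> e != 0 -> (0 < q)%N -> ratM E = e *+ q ->
  has_exponent (smith_group E) q -> fixed_pairing e.
Proof.
move=> ee nze q_gt0 hE hexp.
have nzq : (q%:R : rat) != 0 by rewrite pnatr_eq0 -lt0n.
have {}hE : ratM E = q%:R *: e by rewrite hE scaler_nat.
have [||v [w [wv Ev wE]]] := exponent_eigenvectors _ _ hexp.
- apply: contraNneq nze => E0; move: hE; rewrite E0 /ratM map_mx0 => /esym/eqP.
  by rewrite scaler_eq0 (negPf nzq).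
- apply: ratM_inj; rewrite ratMM ratMZ hE -scalemxAl -scalemxAr ee.
  by [].
exists v, w; split=> //.
- by apply: (scalerI nzq); rewrite scalemxAl -hE -ratMM Ev ratMZ.
- by apply: (scalerI nzq); rewrite scalemxAr -hE -ratMM wE ratMZ.
Qed.

Theorem theorem2p2 (n k : nat) (a : 'I_k.+1 -> int) (X Y : 'M[int]_n.+1)
    (e : 'I_k.+1 -> 'M[rat]_n.+1) (q : 'I_k.+1 -> nat)
    (E : 'I_k.+1 -> 'M[int]_n.+1)
    (a_inj : injective a)
    (minX : has_minpoly X (\prod_(i < k.+1) ('X - (a i)%:P)))
    (minY : has_minpoly Y (\prod_(i < k.+1) ('X - (a i)%:P)))
    (he : forall i, eigen_idempotent (ratM X) (a i)%:~R (e i))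
    (hq : forall i, min_denom (e i) (q i))
    (hE : forall i, ratM (E i) = e i *+ q i)
    (hab :
      (forall i, has_exponent (smith_group (E i)) (q i)) \/
      (\rank (e ord0) = 1%N /\
       forall i, i != ord0 -> has_exponent (smith_group (E i)) (q i))) :
  (exists2 T : 'M[int]_n.+1, T \in unitmx & T *m X *m invmx T = Y) <->
  (forall p : nat, prime p ->
    exists2 T : 'M[rat]_n.+1, in_GL_Zloc p T &
      T *m ratM X *m invmx T = ratM Y).
Proof.
split=> [[T uT TXY] p pp | locconj].
  exists (ratM T).
    split=> [i j|]; first by rewrite mxE; exact: Zloc_int.
    rewrite det_map_mx; move: uT; rewrite unitmxE => /unitz_sqr dd.
    have ddr : (\det T)%:~R * (\det T)%:~R = 1 :> rat by rewrite -intrM dd.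
    have nzd : (\det T)%:~R != 0 :> rat.
      apply: contraTneq isT => d0; move: ddr; rewrite d0 mul0r => /eqP.
      by rewrite eq_sym oner_eq0.
    split=> //; first exact: Zloc_int.
    by rewrite -[_^-1]mul1r -ddr mulfK //; exact: Zloc_int.
  have TXY' : T *m X = Y *m T by rewrite -TXY mulmxKV.
  by rewrite -ratMM TXY' ratMM mulmxK // ratM_unit.
have ee i : e i *m e i = e i by case: (he i) => [[[_ ei]]].
have nze i : e i != 0 by case: (he i) => [[_ ->]].
have /fin_all_exists[g eg] i : exists gi, e i = horner_mx (ratM X) gi.
  by case: (he i) => [[[]]].
have eX_comm i : e i * ratM X = ratM X * e i.
  by rewrite eg; apply/esym; apply: comm_mx_horner.
have minX' : mxminpoly (ratM X) = \prod_i ('X - ((a i)%:~R)%:P).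
  rewrite [LHS]minX rmorph_prod; apply: eq_bigr => i _.
  by rewrite /= map_polyXsubC.
have aQ_inj : injective (fun i => (a i)%:~R : rat).
  by move=> i j /intr_inj /a_inj.
have e_eigen i : (e i == eigenspace (ratM X) (a i)%:~R)%MS by case: (he i).
have eX i := eigen_idempotentE e_eigen i.
have Xe i : ratM X *m e i = (a i)%:~R *: e i.
  by rewrite -[LHS]eX_comm eX.
have orth := eigen_idempotent_orth aQ_inj eX_comm e_eigen.
have sume := eigen_idempotent_sum aQ_inj minX' eX_comm ee e_eigen.
(* Using the polynomial of [e i] at [Y] makes every intertwiner of [X] and [Y] intertwine [e i] and
   [f i] as well. *)
pose f i := horner_mx (ratM Y) (g i).
(* Any prime would do: one rational conjugator transports the properties of the [e i] to the
   [f i]. *)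
have [T2 [T2p [_ nzT2 _]] T2XY] := locconj 2%N isT.
have uT2 : T2 \in unitmx by rewrite unitmxE unitfE.
have T2e i : f i = T2 *m e i *m invmx T2.
  by rewrite eg (horner_mx_intertwine _ (conjugate_intertwine uT2 T2XY)) mulmxK.
have Ye i : ratM Y *m f i = (a i)%:~R *: f i.
  rewrite -T2XY T2e !mulmxA mulmxKV // -[T2 *m _ *m _]mulmxA.
  by rewrite Xe -scalemxAr -scalemxAl.
have ff i : f i *m f i = f i.
  by rewrite T2e !mulmxA mulmxKV // -[_ *m e i *m e i]mulmxA ee.
have sumf : \sum_i f i = 1%:M.
  under eq_bigr do rewrite T2e.
  by rewrite -mulmx_suml -mulmx_sumr [\sum_i _]sume mulmx1 mulmxV.
have rankf i : \rank (f i) = \rank (e i).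
  rewrite T2e mxrankMfree ?row_free_unit ?unitmx_inv //.
  by rewrite eqmxMfull // row_full_unit.
have ef T : T *m X = Y *m T -> forall i, ratM T *m e i = f i *m ratM T.
  by move=> TXY i; rewrite eg; apply: horner_mx_intertwine; rewrite -!ratMM TXY.
(* Both splittings use the rank of [e i], so the blocks [C T i] are square. *)
have splite i := idempotent_split (ee i) (erefl (\rank (e i))).
have splitf i := idempotent_split (ff i) (rankf i).
have [P /fin_all_exists[Q /fin_all_exists[S PQS]]] := fin_all_exists splite.
have [P' /fin_all_exists[Q' /fin_all_exists[S' PQS']]] := fin_all_exists splitf.
have loc p : prime p ->
    exists2 T : 'M[int]_n.+1, T *m X = Y *m T & ~~ (p %| \det T)%Z.
  by move=> pp; have [T Tp TXY] := locconj p pp; apply: local_intertwiner pp Tp TXY.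
have pairing i : has_exponent (smith_group (E i)) (q i) -> fixed_pairing (e i).
  by apply: fixed_pairing_exponent (hE i) => //; case: (hq i).
have [|T uT TXY] := @intertwiner_unimodular _ _ a X Y e f orth sumf eX Xe Ye ef
  _ P P' Q Q' S S' (fun i => let: And3 h _ _ := PQS i in h)
  (fun i => let: And3 _ h _ := PQS i in h) (fun i => let: And3 _ _ h := PQS i in h)
  (fun i => let: And3 h _ _ := PQS' i in h)
  (fun i => let: And3 _ h _ := PQS' i in h) (fun i => let: And3 _ _ h := PQS' i in h)
  _ loc.
  case: hab => [hx | [rk hx]]; first by left=> i; exact: pairing.
  by right; exists ord0 => // i ni; apply: pairing; exact: hx.
by exists T; rewrite // TXY mulmxK.
Qed.
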